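(* Let $P\subset\mathbb{R}^3_{>0}$ be a finite set and let $B\subset\mathbb{R}^3_{>0}$ be a fixed finite nonempty baseline set. Then the set function $I_B:2^P\to\mathbb{R}_{\ge 0}$, $I_B(S)=R_2(B)-R_2(B\cup S)$, is monotone nondecreasing and submodular.
   Context: Let $\Delta_2=\{w\in\mathbb{R}^3_{\ge 0}:w_1+w_2+w_3=1\}$, with $\mathrm{d}w$ two-dimensional (unnormalized) Lebesgue measure on $\Delta_2$ in the coordinates $(w_1,w_2)$, so that $\Delta_2$ has total measure $1/2$. For $p\in\mathbb{R}^3_{>0}$ and $w\in\Delta_2$ let $g_p(w)=\max\{w_1p_1,w_2p_2,w_3p_3\}$. For a finite nonempty set $S\subset\mathbb{R}^3_{>0}$ let $\tau_S(w)=\min_{p\in S}g_p(w)$ and $R_2(S)=\int_{\Delta_2}\tau_S(w)\,\mathrm{d}w$. A set function $F:2^P\to\mathbb{R}$ is monotone nondecreasing if $F(A)\le F(C)$ whenever $A\subseteq C\subseteq P$, and submodular if $F(A\cup\{q\})-F(A)\ge F(C\cup\{q\})-F(C)$ for all $A\subseteq C\subseteq P$ and $q\in P\setminus C$. *)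

(* Defs.v *)
From mathcomp Require Import all_boot all_order all_algebra finmap.
From mathcomp Require Import all_classical all_reals all_analysis.
Set Implicit Arguments. Unset Strict Implicit. Unset Printing Implicit Defensive.
Import Order.TTheory GRing.Theory Num.Theory.
Local Open Scope classical_set_scope.
Local Open Scope ring_scope.

Definition posvec (R : realType) (p : 'rV[R]_3) : Prop :=
  forall i, 0 < p 0 i.

Definition simplex2 (R : realType) : set 'rV[R]_3 :=
  [set w | (forall i, 0 <= w 0 i) /\ w 0 0 + w 0 1 + w 0 2 = 1].

Definition gmax (R : realType) (p w : 'rV[R]_3) : R :=
  Num.max (Num.max (w 0 0 * p 0 0) (w 0 1 * p 0 1)) (w 0 2 * p 0 2).

(* The minimum is taken in the extended reals, where +oo is the neutral
   element of min; for S nonempty the value is finite and [fine] is harmless. *)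
Definition tau (R : realType) (S : {fset 'rV[R]_3}) (w : 'rV[R]_3) : R :=
  fine (\big[Order.min/+oo%E]_(p <- S) (gmax p w)%:E)%E.

(* The affine parametrization of the plane w_1 + w_2 + w_3 = 1 by its first
   two coordinates. *)
Definition chart (R : realType) (u : R * R) : 'rV[R]_3 :=
  \row_(i < 3) [:: u.1; u.2; 1 - u.1 - u.2]`_i.

(* Integration over the simplex is with respect to planar Lebesgue measure in
   the coordinates (w_1, w_2); the simplex then has measure 1/2. *)
Definition R2 (R : realType) (S : {fset 'rV[R]_3}) : R :=
  \int[(@lebesgue_measure R \x @lebesgue_measure R)%E]_(u in
     @chart R @^-1` @simplex2 R) tau S (chart u).

Definition improvement (R : realType) (B S : {fset 'rV[R]_3}) : R :=
  R2 B - R2 (B `|` S)%fset.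

(* Set functions on the subsets of P are represented by functions on all
   finite sets; only their values on subsets of P matter below. *)
Definition monotone_on (T : choiceType) (R : realType) (P : {fset T})
    (F : {fset T} -> R) : Prop :=
  forall A C : {fset T}, (A `<=` C)%fset -> (C `<=` P)%fset -> F A <= F C.

Definition submodular_on (T : choiceType) (R : realType) (P : {fset T})
    (F : {fset T} -> R) : Prop :=
  forall (A C : {fset T}) (q : T),
    (A `<=` C)%fset -> (C `<=` P)%fset -> q \in P -> q \notin C ->
    F (A `|` [fset q])%fset - F A >= F (C `|` [fset q])%fset - F C.

(* Main.v *)
(* Pointwise, adding q replaces tau_S by min(tau_S, g_q), so the gain is the
   positive part of tau_S - g_q; it is nondecreasing in tau_S, and tau_S is
   antitone in S. Integrating this inequality over the simplex gives the
   theorem. *)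
Require Import Defs.
From mathcomp Require Import all_boot all_order all_algebra finmap.
From mathcomp Require Import all_classical all_reals all_analysis.
From mathcomp Require Import measurable_realfun lra.
Import Order.TTheory GRing.Theory Num.Theory.
Local Open Scope ring_scope.

Section EnvelopeOrder.
Context {R : realType}.
Implicit Types (S T : {fset 'rV[R]_3}) (p w : 'rV[R]_3).

(** One member of [S] bounds the minimum away from [+oo], the value that [fine] would send to 0. *)
Lemma tau_fin S w : S != fset0 ->
  (tau S w)%:E = (\big[Order.min/+oo%E]_(p <- S) (gmax p w)%:E)%E.
Proof.
move=> /fset0Pn[p pS]; rewrite /tau fineK//.
rewrite fin_numElt; apply/andP; split.
  elim/big_ind: _ => [|x y ? ?|x _]; first by [].
    by rewrite lt_min; apply/andP.
  exact: ltNyr.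
by apply: (le_lt_trans _ (ltry (gmax p w))); apply: bigmin_inf_seq pS _ _.
Qed.

(** The universal property of the minimum: the order facts below follow from it without unfolding
    [fine]. *)
Lemma le_tauP S w t : S != fset0 ->
  reflect {in S, forall p, t <= gmax p w} (t <= tau S w).
Proof.
move=> S0; rewrite -lee_fin tau_fin//.
(* In the extended reals this also holds for the empty list, where the minimum is [+oo], so
   induction on the list can start there. *)
have -> : (t%:E <= \big[Order.min/+oo]_(p <- S) (gmax p w)%:E)%E =
          all (fun p => t <= gmax p w) S.
  elim: (S : seq _) => [|p s IH]; first by rewrite big_nil leey.
  by rewrite big_cons le_min IH lee_fin.
exact: allP.
Qed.

Lemma tau_le S w p : p \in S -> tau S w <= gmax p w.
Proof.
move=> pS; have S0 : S != fset0 by apply/fset0Pn; exists p.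
exact: (elimT (le_tauP S w _ S0)).
Qed.

Lemma tau_anti S T w : S != fset0 -> (S `<=` T)%fset -> tau T w <= tau S w.
Proof.
move=> S0 /fsubsetP ST; apply/le_tauP => // p pS.
exact/tau_le/ST.
Qed.

Lemma tau_fsetU1 S w q : S != fset0 ->
  tau (S `|` [fset q])%fset w = Num.min (tau S w) (gmax q w).
Proof.
move=> S0; apply/eqP; rewrite eq_le le_min -andbA; apply/and3P; split.
- exact: tau_anti (fsubsetUl _ _).
- by apply: tau_le; rewrite !inE eqxx orbT.
- apply/le_tauP => [|p].
    by apply/fset0Pn; exists q; rewrite !inE eqxx orbT.
  rewrite !inE ge_min => /orP[pS|/eqP->]; last by rewrite lexx orbT.
  by rewrite tau_le.
Qed.

Lemma tau_diminishing S T w q : S != fset0 -> (S `<=` T)%fset ->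
  tau T w - tau (T `|` [fset q])%fset w <= tau S w - tau (S `|` [fset q])%fset w.
Proof.
move=> S0 ST; have TS := tau_anti S T w S0 ST.
have T0 : T != fset0.
  by apply: contraNneq S0 => T0; move: ST; rewrite T0 fsubset0.
rewrite !tau_fsetU1// lerBrDr.
by case: (leP (tau T w)); case: (leP (tau S w)) => ? ?; lra.
Qed.

End EnvelopeOrder.

Section EnvelopeIntegral.
Context {R : realType}.
Implicit Types (S T : {fset 'rV[R]_3}) (p : 'rV[R]_3).
Local Notation mu := (@lebesgue_measure R \x @lebesgue_measure R)%E.
Local Notation D := (@chart R @^-1` @simplex2 R)%classic.

(** The coordinates of [chart u] sum to 1 by construction, so only the sign conditions remain. *)
Lemma chart_simplexE :
  D = [set u : R * R | [/\ 0 <= u.1, 0 <= u.2 & 0 <= 1 - u.1 - u.2]]%classic.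
Proof.
apply/seteqP; split => u /=.
  by move=> [w0 _]; have := (w0 0, w0 1, w0 2); rewrite !mxE/= => -[[]].
move=> [? ? ?]; split; last by rewrite !mxE/=; lra.
by case=> -[|[|[]]]//= i; rewrite mxE.
Qed.

Lemma measurable_gmax_chart p :
  measurable_fun [set: R * R]%classic (fun u => gmax p (chart u)).
Proof.
rewrite /gmax; apply: measurable_maxr; first apply: measurable_maxr;
  apply: measurable_funM => //; under eq_fun do rewrite mxE /=.
- exact: measurable_fst.
- exact: measurable_snd.
- by do 2!apply: measurable_funB => //.
Qed.

Lemma measurable_tau_chart S :
  measurable_fun [set: R * R]%classic (fun u => tau S (chart u)).
Proof.
(* Peeling off [fine] first lets the induction run on extended-real minima, from the constant
   [+oo]. *)
apply: (measurableT_comp (fine_measurable measurableT)) => //.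
elim: (S : seq _) => [|p s IH].
  by under eq_fun do rewrite big_nil; exact: measurable_cst.
under eq_fun do rewrite big_cons.
apply: measurable_mine => //; by apply/measurable_EFinP; exact: measurable_gmax_chart.
Qed.

Lemma measurable_chart_simplex : measurable D.
Proof.
have -> : D = ([set u | 0 <= u.1] `&` ([set u | 0 <= u.2] `&`
    [set u | 0 <= 1 - u.1 - u.2]))%classic.
  by rewrite chart_simplexE; apply/seteqP; split=> u /=; [case|case=> ? []].
have ge0_measurable (f : R * R -> R) :
    measurable_fun [set: R * R]%classic f -> measurable [set u | 0 <= f u]%classic.
  by move=> mf; rewrite -[X in measurable X]setTI; exact: measurable_fun_le.
apply: measurableI; first exact: ge0_measurable measurable_fst.
apply: measurableI; first exact: ge0_measurable measurable_snd.
apply: ge0_measurable.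
by do 2!apply: measurable_funB => //.
Qed.

Lemma chart_simplex_fin : (mu D < +oo)%E.
Proof.
(* The domain is enclosed in the unit square, of measure 1. *)
apply: (@le_lt_trans _ _ (mu (`[0, 1] `*` `[0, 1])%classic)).
  apply: le_measure; rewrite ?inE.
  - exact: measurable_chart_simplex.
  - exact: measurableX.
  - rewrite chart_simplexE => u /= [? ? ?]; rewrite !in_itv/=.
    by split; apply/andP; split => //; lra.
rewrite product_measure1E//=.
by rewrite lebesgue_measure_itv/= lte_fin ltr01 -EFinB -EFinM ltry.
Qed.

(** A bounded measurable function on a domain of finite measure is integrable. *)
Lemma integrable_tau S : S != fset0 -> (forall p, p \in S -> posvec p) ->
  mu.-integrable D (EFin \o (fun u => tau S (chart u))).
Proof.
move=> S0 S_pos; apply: measurable_bounded_integrable.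
- exact: measurable_chart_simplex.
- exact: chart_simplex_fin.
- exact: measurable_funTS (measurable_tau_chart S).
have /fset0Pn[b bS] := S0.
have bp i := ltW (S_pos b bS i).
(* On the simplex each weight is at most 1, so [tau S] is at most [gmax b], hence at most the sum of
   the coordinates of [b]. Positivity of [S] gives the lower bound 0. *)
exists (b 0 0 + b 0 1 + b 0 2); split; rewrite ?num_real// => M bM u [w0 w1].
rewrite /= ger0_norm; last first.
  apply/le_tauP => // p pS; rewrite /gmax !le_max.
  by rewrite mulr_ge0// ltW// S_pos.
apply: (le_trans (tau_le S (chart u) b bS)); apply/ltW/le_lt_trans/bM.
have := (bp 0, bp 1, bp 2, w0 0, w0 1, w0 2); move: w1 => + [[[[[]]]]].
move: (chart u) => w *; rewrite /gmax !ge_max -andbA.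
by apply/and3P; split; nra.
Qed.

End EnvelopeIntegral.

Theorem theorem4p2 (R : realType) (P B : {fset 'rV[R]_3})
    (P_pos : forall p, p \in P -> posvec p)
    (B_pos : forall b, b \in B -> posvec b)
    (B_neq0 : B != fset0) :
  [/\ forall S : {fset 'rV[R]_3}, (S `<=` P)%fset -> 0 <= improvement B S,
      monotone_on P (improvement B)
    & submodular_on P (improvement B)].
Proof.
have BS_neq0 S : (B `|` S)%fset != fset0.
  by apply: contraNneq B_neq0; rewrite -fsubset0 => <-; exact: fsubsetUl.
have BS_int S : (S `<=` P)%fset ->
    (@lebesgue_measure R \x @lebesgue_measure R)%E.-integrable
      (@chart R @^-1` @simplex2 R)%classic
      (EFin \o (fun u => tau (B `|` S)%fset (chart u))).
  move=> /fsubsetP SP; apply: integrable_tau => // p.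
  by rewrite inE => /orP[/B_pos|/SP/P_pos].
have mD := @measurable_chart_simplex R.
have mono : monotone_on P (improvement B).
  (* The common term [R2 B] cancels, and the sign turns antitonicity of [tau] into monotonicity. *)
  move=> A C AC CP; rewrite lerB// le_Rintegral//.
  - exact: BS_int.
  - exact/BS_int/(fsubset_trans AC).
  - by move=> u _; apply: tau_anti => //; exact: fsetUS.
split=> //.
  (* Nonnegativity is monotonicity from the empty set, where the improvement vanishes. *)
  move=> S SP; have := mono fset0 S (fsub0set _) SP.
  by rewrite {1}/improvement fsetU0 subrr.
move=> A C q AC CP qP _.
have BSq_int S : (S `<=` P)%fset ->
    (@lebesgue_measure R \x @lebesgue_measure R)%E.-integrable
      (@chart R @^-1` @simplex2 R)%classic
      (EFin \o (fun u => tau (B `|` S `|` [fset q])%fset (chart u))).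
  by move=> SP; rewrite -fsetUA; apply: BS_int; rewrite fsubUset SP fsub1set.
(* [R2 B] cancels from the marginal gain, and linearity merges the other two integrals, so that
   submodularity reduces to a pointwise comparison of integrands. *)
have gainE S : (S `<=` P)%fset ->
    improvement B (S `|` [fset q])%fset - improvement B S =
    \int[(@lebesgue_measure R \x @lebesgue_measure R)%E]_(u in
        (@chart R @^-1` @simplex2 R)%classic)
      (tau (B `|` S)%fset (chart u) -
       tau (B `|` S `|` [fset q])%fset (chart u)).
  move=> SP; rewrite RintegralB//; [|exact: BS_int|exact: BSq_int].
  by rewrite /improvement fsetUA /R2; lra.
have gain_int S : (S `<=` P)%fset ->
    (@lebesgue_measure R \x @lebesgue_measure R)%E.-integrable
      (@chart R @^-1` @simplex2 R)%classic
      (EFin \o (fun u => tau (B `|` S)%fset (chart u) -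
         tau (B `|` S `|` [fset q])%fset (chart u))).
  by move=> SP; exact: (integrableB _ (BS_int S SP) (BSq_int S SP)).
have AP := fsubset_trans AC CP.
(* The integrands are compared by [tau_diminishing], applied to the unions of [B] with [A] and with
   [C]. *)
rewrite !gainE// le_Rintegral//; try exact: gain_int.
by move=> u _; apply: tau_diminishing => //; exact: fsetUS.
Qed.
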